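(* Let $\mathcal A$ be a countable structure. The following are equivalent: (1) There is a continuous homomorphism from $\mathrm{Aut}(\mathcal A)$ onto $\mathrm{Aut}(\mathbb Q,<)$. (2) There are $n\in\omega$, an $\mathcal L_{\omega_1\omega}$-definable (without parameters) set $D\subseteq A^n$, an $\mathcal L_{\omega_1\omega}$-definable equivalence relation $E\subseteq D^2$ with infinitely many equivalence classes, and an $\mathcal L_{\omega_1\omega}$-definable order on the $E$-classes, such that the $E$-equivalence classes are order indiscernible, i.e., each order-preserving permutation of the $E$-equivalence classes extends to an automorphism of $\mathcal A$.
   Context: $\mathcal A$ has domain $\omega$; automorphism groups carry the topology of pointwise convergence. An automorphism $g$ of $\mathcal A$ extends a permutation $h$ of the $E$-classes if $g$, acting coordinatewise on $A^n$, maps each $E$-class $C$ onto $h(C)$.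
   Formalization: ''Order indiscernible'' also requires that any two increasing finite sequences of classes of equal length be conjugate by an automorphism, and ''order'' means linear order; with the ''i.e.'' clause alone, (ω,<) with equality satisfies (2) but not (1). *)

(* Defs.v *)
From HB Require Import structures.
From mathcomp Require Import all_boot all_order all_algebra.
From mathcomp Require Import all_classical all_reals all_analysis.

Set Implicit Arguments.
Unset Strict Implicit.
Unset Printing Implicit Defensive.

Local Open Scope classical_set_scope.

(* Constants are function symbols of arity 0. *)
Record language := Language {
  fsym : Type; far : fsym -> nat;
  rsym : Type; rar : rsym -> nat }.

Record structure (L : language) (T : Type) := Structure {
  fint : forall f : fsym L, (far f).-tuple T -> T;
  rint : forall r : rsym L, (rar r).-tuple T -> Prop }.

(* [formula L n] is the type of formulas whose free variables are among
   x_0, ..., x_(n-1); a quantifier binds variable 0 and shifts the others up.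
   Conjunctions and disjunctions are indexed by nat; finite nonempty ones are
   obtained by repetition, and the empty ones are equivalent to
   [forall x, x = x] and its negation. *)
Inductive term (L : language) (n : nat) :=
| Var of 'I_n
| App (f : fsym L) of 'I_(far f) -> term L n.

Inductive formula (L : language) : nat -> Type :=
| FEq n : term L n -> term L n -> formula L n
| FRel n (r : rsym L) : ('I_(rar r) -> term L n) -> formula L n
| FNot n : formula L n -> formula L n
| FConj n : (nat -> formula L n) -> formula L n
| FDisj n : (nat -> formula L n) -> formula L n
| FExists n : formula L n.+1 -> formula L n
| FForall n : formula L n.+1 -> formula L n.

Fixpoint eval (L : language) (T : Type) (M : structure L T) (n : nat)
    (v : n.-tuple T) (t : term L n) : T :=
  match t with
  | Var i => tnth v i
  | App f ts => fint M [tuple eval M v (ts i) | i < far f]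
  end.

Fixpoint sat (L : language) (T : Type) (M : structure L T) (n : nat)
    (phi : formula L n) : n.-tuple T -> Prop :=
  match phi in formula _ n return n.-tuple T -> Prop with
  | FEq _ t u => fun v => eval M v t = eval M v u
  | FRel _ r ts => fun v => rint M [tuple eval M v (ts i) | i < rar r]
  | FNot _ p => fun v => ~ sat M p v
  | FConj _ ps => fun v => forall k, sat M (ps k) v
  | FDisj _ ps => fun v => exists k, sat M (ps k) v
  | FExists _ p => fun v => exists a, sat M p [tuple of a :: v]
  | FForall _ p => fun v => forall a, sat M p [tuple of a :: v]
  end.

Definition definable (L : language) (T : Type) (M : structure L T) (n : nat)
    (D : set (n.-tuple T)) : Prop :=
  exists phi : formula L n, forall x, D x <-> sat M phi x.

Definition definable2 (L : language) (T : Type) (M : structure L T) (n : nat)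
    (R : n.-tuple T -> n.-tuple T -> Prop) : Prop :=
  exists phi : formula L (n + n), forall x y, R x y <-> sat M phi [tuple of x ++ y].

Section Automorphisms.
Context {L : language} {T : choiceType} (M : structure L T).

Record Aut := MkAut {
  aut_fun :> T -> T;
  aut_inv : T -> T;
  autK : cancel aut_fun aut_inv;
  autKV : cancel aut_inv aut_fun;
  aut_fint : forall (f : fsym L) (x : (far f).-tuple T),
    fint M (map_tuple aut_fun x) = aut_fun (fint M x);
  aut_rint : forall (r : rsym L) (x : (rar r).-tuple T),
    rint M (map_tuple aut_fun x) <-> rint M x }.

Lemma aut_eq (g h : Aut) : g =1 h -> g = h.
Proof.
case: g h => [g g' gK gKV gf gr] [h h' hK hKV hf hr] /= /funext gh.
subst h; have gh' : g' = h' by apply/funext => x; rewrite -[x in LHS]hKV gK.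
by subst h'; congr MkAut; exact: Prop_irrelevance.
Qed.

Lemma map_tuple_comp (f g : T -> T) n (x : n.-tuple T) :
  map_tuple (f \o g) x = map_tuple f (map_tuple g x).
Proof. by apply: val_inj; rewrite /= map_comp. Qed.

Lemma map_tuple_id n (x : n.-tuple T) : map_tuple id x = x.
Proof. by apply: val_inj; rewrite /= map_id. Qed.

Definition aut_one : Aut.
Proof.
exists id id => // [f x|r x]; first by rewrite map_tuple_id.
by rewrite map_tuple_id.
Defined.

Definition aut_comp (g h : Aut) : Aut.
Proof.
exists (g \o h) (aut_inv h \o aut_inv g) => [x|x|f x|r x] /=.
- by rewrite !autK.
- by rewrite !autKV.
- by rewrite map_tuple_comp !aut_fint.
- by rewrite map_tuple_comp !aut_rint.
Defined.

Lemma map_tuple_autKV (g : Aut) n (x : n.-tuple T) :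
  map_tuple g (map_tuple (aut_inv g) x) = x.
Proof.
by rewrite -map_tuple_comp (_ : g \o _ = id) ?map_tuple_id //; apply/funext/autKV.
Qed.

Definition aut_opp (g : Aut) : Aut.
Proof.
exists (aut_inv g) g => [|| f x | r x].
- exact: autKV.
- exact: autK.
- by rewrite -[x in RHS](map_tuple_autKV g) aut_fint autK.
- by rewrite -[x in X in _ <-> X](map_tuple_autKV g) aut_rint.
Defined.

HB.instance Definition _ := gen_eqMixin Aut.
HB.instance Definition _ := gen_choiceMixin Aut.

Fact aut_mulA : associative aut_comp.
Proof. by move=> f g h; exact: aut_eq. Qed.
Fact aut_mul1g : left_id aut_one aut_comp.
Proof. by move=> g; exact: aut_eq. Qed.
Fact aut_mulg1 : right_id aut_one aut_comp.
Proof. by move=> g; exact: aut_eq. Qed.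
Fact aut_mulVg : left_inverse aut_one aut_opp aut_comp.
Proof. by move=> g; apply: aut_eq => x /=; rewrite autK. Qed.
Fact aut_mulgV : right_inverse aut_one aut_opp aut_comp.
Proof. by move=> g; apply: aut_eq => x /=; rewrite autKV. Qed.

HB.instance Definition _ :=
  isGroup.Build Aut aut_mulA aut_mul1g aut_mulg1 aut_mulVg aut_mulgV.

(* T is given the discrete topology explicitly: the default topology of a
   type such as rat is not discrete. *)
Definition aut_ptws (g : Aut) : {ptws T -> discrete_topology T} := g.

HB.instance Definition _ := Topological.copy Aut (initial_topology aut_ptws).

End Automorphisms.

Definition order_language : language :=
  @Language void (fun _ => 0) unit (fun _ => 2).

Definition rat_lt : structure order_language rat :=
  @Structure order_language rat
    (fun f => match f with end)
    (fun _ x => (tnth x ord0 < tnth x ord_max)%R).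

Section Classes.
Context {L : language} {T : choiceType} (M : structure L T) (n : nat).
Implicit Types (D C : set (n.-tuple T)) (E : n.-tuple T -> set (n.-tuple T)).
Implicit Types (K : set (set (n.-tuple T))).
Implicit Types (lt : set (n.-tuple T) -> set (n.-tuple T) -> Prop).

Definition equivalence_on D E : Prop :=
  [/\ forall x y, E x y -> D x /\ D y,
      forall x, D x -> E x x,
      forall x y, E x y -> E y x &
      forall x y z, E x y -> E y z -> E x z].

Definition classes D E : set (set (n.-tuple T)) := [set E x | x in D].

Definition strict_linear_order_on K lt : Prop :=
  [/\ forall C, K C -> ~ lt C C,
      forall C1 C2 C3, K C1 -> K C2 -> K C3 -> lt C1 C2 -> lt C2 C3 -> lt C1 C3 &
      forall C1 C2, K C1 -> K C2 -> [\/ lt C1 C2, C1 = C2 | lt C2 C1]].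

Definition definable_order D E lt : Prop :=
  strict_linear_order_on (classes D E) lt /\
  definable2 M (fun x y => [/\ D x, D y & lt (E x) (E y)]).

Definition aut_image (g : Aut M) C : set (n.-tuple T) :=
  [set map_tuple g x | x in C].

Definition order_preserving_perm K lt
    (h : set (n.-tuple T) -> set (n.-tuple T)) : Prop :=
  set_bij K K h /\ forall C1 C2, K C1 -> K C2 -> (lt C1 C2 <-> lt (h C1) (h C2)).

Definition extends_perm K (g : Aut M) h : Prop :=
  forall C, K C -> aut_image g C = h C.

Definition increasing_in K lt k (c : 'I_k -> set (n.-tuple T)) : Prop :=
  (forall i, K (c i)) /\ forall i j : 'I_k, (i < j)%N -> lt (c i) (c j).

(* The first clause is the usual meaning of order indiscernibility: any two
   increasing finite sequences of classes of the same length are conjugate.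
   It does not follow from the second one: a rigid order, such as one of type
   omega, has no order-preserving permutation besides the identity.  Nor does
   it imply the second one, which is about permutations of all the classes. *)
Definition order_indiscernible K lt : Prop :=
  (forall k (c d : 'I_k -> set (n.-tuple T)),
     increasing_in K lt c -> increasing_in K lt d ->
     exists g : Aut M, forall i, aut_image g (c i) = d i) /\
  (forall h, order_preserving_perm K lt h ->
     exists g : Aut M, extends_perm K g h).

End Classes.

(* Main.v *)
(* From (1) to (2): by continuity, the stabilizer of 0 under F contains the
   pointwise stabilizer of a finite tuple a, so F g 0 depends only on the tuple
   g a.  The tuples g a with F g 0 = q form a class for each rational q, and
   Aut(A) acts on these classes as it does on Q through F.  Definability is
   Scott's theorem that every automorphism-invariant relation of a countable
   structure is L_(omega1 omega)-definable.
   From (2) to (1): homogeneity makes the classes a countable dense linear order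
   without endpoints, and Aut(A) acts on it; order-preserving permutations of
   the classes lift, so the action is onto Aut(Q,<).
   Scott's theorem, Cantor's theorem and the homogeneity of Q are all instances
   of one back-and-forth argument. *)
Require Import Defs.
From HB Require Import structures.
From mathcomp Require Import all_boot all_order all_algebra.
From mathcomp Require Import all_classical all_reals all_analysis.

Local Open Scope classical_set_scope.

Set Implicit Arguments.
Unset Strict Implicit.
Unset Printing Implicit Defensive.

Import Order.TTheory GRing.Theory Num.Theory.

(** * The pointwise topology *)

Section PointwiseTopology.
Context {L : language} {T : choiceType} (M : structure L T).

(** Evaluation at [x] is continuous and the singleton of [g x] is open in the discrete topology. *)
Lemma aut_nbhs_eval (g : Aut M) (x : T) : nbhs g [set h : Aut M | h x = g x].
Proof.
have ev : {for aut_ptws g, continuous (fun f : {ptws T -> discrete_topology T} => f x)}.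
  exact: proj_continuous.
have nb : nbhs (aut_ptws g) [set f : {ptws T -> discrete_topology T} | f x = g x].
  by apply: (ev [set g x]); exact: discrete_set1.
exact: (@initial_continuous _ _ (@aut_ptws L T M) g _ nb).
Qed.

Lemma aut_nbhs_tuple (g : Aut M) n (x : n.-tuple T) :
  nbhs g [set h : Aut M | map_tuple h x = map_tuple g x].
Proof.
have := @filter_forall _ _ (fun (i : 'I_n) (h : Aut M) => h (tnth x i) = g (tnth x i))
  (nbhs g) (nbhs_filter g) (fun i => aut_nbhs_eval g (tnth x i)).
by apply: filterS => h hx; apply: eq_from_tnth => i; rewrite !tnth_map.
Qed.

(** The topology is initial for a map into a product, so convergence is tested one coordinate at a
    time, where discreteness asks for eventual equality. *)
Lemma aut_cvg (F : set_system (Aut M)) (g : Aut M) : Filter F ->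
  (forall x, F [set h : Aut M | h x = g x]) -> F --> g.
Proof.
move=> FF Fg.
have cv : @aut_ptws L T M @ F --> aut_ptws g.
  apply/cvg_sup => x U.
  move=> [_ [[W _ <-] Wg] WU]; change (F (@aut_ptws L T M @^-1` U)).
  apply: filterS (Fg x) => h /= hx; apply: WU.
  by rewrite /= /aut_ptws hx.
move=> A [_ [[B Bo <-] Bg] BA]; apply: filterS BA _.
by apply: cv; apply: open_nbhs_nbhs.
Qed.

(** The sets that contain all automorphisms agreeing with [g] on some finite list form a filter; it
    converges to [g], hence contains every neighbourhood of [g]. *)
Lemma aut_nbhs_finite (g : Aut M) (U : set (Aut M)) : nbhs g U ->
  exists s : seq T, forall h : Aut M, {in s, h =1 g} -> U h.
Proof.
pose F : set_system (Aut M) := [set V |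
  exists s : seq T, forall h : Aut M, {in s, h =1 g} -> V h].
suff : F --> g by move=> /[apply].
apply: aut_cvg.
  split; first by exists [::].
  - move=> P Q [s sP] [t tQ]; exists (s ++ t) => h hst; split.
      by apply: sP => x xs; apply: hst; rewrite mem_cat xs.
    by apply: tQ => x xs; apply: hst; rewrite mem_cat xs orbT.
  - by move=> P Q PQ [s sP]; exists s => h /sP /PQ.
by move=> x; exists [:: x] => h; apply; rewrite mem_seq1.
Qed.

End PointwiseTopology.

(** * Back and forth, and countable dense linear orders *)

Section BackAndForth.
Context {T1 T2 : eqType} (e1 : nat -> T1) (e2 : nat -> T2).
Hypotheses (e1_surj : forall x, exists k, e1 k = x)
  (e2_surj : forall y, exists k, e2 k = y).
Context (P : seq (T1 * T2) -> Prop).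
Hypotheses
  (Pinj : forall s x y x' y', P s -> (x, y) \in s -> (x', y') \in s ->
     (x = x' <-> y = y'))
  (Pforth : forall s x, P s -> exists y, P ((x, y) :: s))
  (Pback : forall s y, P s -> exists x, P ((x, y) :: s)).

(** Round [k] adds [e1 k] to the domain and [e2 k] to the range; the union of the stages is the
    graph of a bijection. The last clause transfers to [f] the properties of members of [P] that
    concern finitely many points at a time. *)
Lemma back_and_forth s0 : P s0 -> exists (f : T1 -> T2) (g : T2 -> T1),
  [/\ cancel f g, cancel g f,
      forall x y, (x, y) \in s0 -> f x = y &
      forall xs : seq T1, exists2 s, P s & forall x, x \in xs -> (x, f x) \in s].
Proof.
move=> Ps0.
(* One round of the construction, made total for the choice: outside [P] nothing is asked of the
   result. *)
have /choice[step stepP] : forall a : nat * seq (T1 * T2), exists s', P a.2 ->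
    [/\ P s', {subset a.2 <= s'}, exists y, (e1 a.1, y) \in s' &
        exists x, (x, e2 a.1) \in s'].
  move=> [k s] /=; have [Ps|nPs] := pselect (P s); last by exists s.
  have [y Py] := Pforth (e1 k) Ps; have [x Px] := Pback (e2 k) Py.
  exists ((x, e2 k) :: (e1 k, y) :: s) => _; split => //.
  - by move=> z zs; rewrite !inE zs !orbT.
  - by exists y; rewrite !inE eqxx orbT.
  - by exists x; rewrite inE eqxx.
pose S := fix S k := if k is k'.+1 then step (k', S k') else s0.
have PS k : P (S k) by elim: k => //= k /(stepP (k, _)) [].
have Ssub k k' z : (k <= k')%N -> z \in S k -> z \in S k'.
  elim: k' => [|k' IH]; first by rewrite leqn0 => /eqP ->.
  rewrite leq_eqVlt => /predU1P[->//|/IH{}IH /IH].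
  by case: (stepP (k', S k') (PS k')) => _ + _ _; apply.
(* Pairs added at different stages both belong to the later one, where [Pinj] compares them. *)
have Sinj k k' x y x' y' : (x, y) \in S k -> (x', y') \in S k' ->
    (x = x' <-> y = y').
  move=> /(Ssub _ _ _ (leq_maxl k k')) + /(Ssub _ _ _ (leq_maxr k k')).
  exact: Pinj.
have /choice[f fP] : forall x, exists y, exists k, (x, y) \in S k.
  move=> x; have [k <-] := e1_surj x; have [_ _ [y ys] _] := stepP (k, S k) (PS k).
  by exists y, k.+1.
have /choice[g gP] : forall y, exists x, exists k, (x, y) \in S k.
  move=> y; have [k <-] := e2_surj y; have [_ _ _ [x xs]] := stepP (k, S k) (PS k).
  by exists x, k.+1.
exists f, g; split.
- by move=> x; have [k fk] := fP x; have [k' gk] := gP (f x); apply/(Sinj _ _ _ _ _ _ gk fk).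
- by move=> y; have [k gk] := gP y; have [k' fk] := fP (g y); apply/(Sinj _ _ _ _ _ _ fk gk).
- by move=> x y xy; have [k fk] := fP x; apply/(Sinj k 0%N _ _ _ _ fk xy).
move=> xs; suff [k kP] : exists k, forall x, x \in xs -> (x, f x) \in S k.
  by exists (S k).
elim: xs => [|x xs [k IH]]; first by exists 0%N.
have [k' fk] := fP x; exists (maxn k k') => z; rewrite inE => /predU1P[->|/IH].
  exact: Ssub (leq_maxr _ _) fk.
exact: Ssub (leq_maxl _ _).
Qed.

End BackAndForth.

(** * Cantor's theorem for countable dense linear orders without endpoints *)

Section DenseOrders.

(** Nonemptiness is not among the axioms; lemmas that need a point get it from [inhabited] or from
    an enumeration. *)
Record dense_order (T : Type) (lt : T -> T -> Prop) : Prop := DenseOrder {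
  do_irr : forall x, ~ lt x x;
  do_trans : forall x y z, lt x y -> lt y z -> lt x z;
  do_total : forall x y, [\/ lt x y, x = y | lt y x];
  do_dense : forall x y, lt x y -> exists z, lt x z /\ lt z y;
  do_right : forall x, exists y, lt x y;
  do_left : forall x, exists y, lt y x }.

(** The maximum is described through its strict upper bounds, which avoids introducing a weak
    order. *)
Lemma finite_max (T : eqType) (lt : T -> T -> Prop) (s : seq T) x :
  dense_order lt -> exists2 m, m \in x :: s &
    forall z, lt m z -> forall y, y \in x :: s -> lt y z.
Proof.
move=> dl; elim: s x => [|x' s IH] x.
  by exists x; rewrite ?mem_seq1// => z xz y; rewrite mem_seq1 => /eqP ->.
have [m ms mP] := IH x'.
have [xm|xm|mx] := do_total dl x m.
- exists m; first by rewrite inE ms orbT.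
  by move=> z mz y; rewrite inE => /predU1P[->|/mP]; [exact: (do_trans dl) mz|apply].
- exists m; first by rewrite inE ms orbT.
  by move=> z mz y; rewrite inE => /predU1P[->|/mP]; [rewrite xm|apply].
- exists x; first by rewrite inE eqxx.
  move=> z xz y; rewrite inE => /predU1P[->//|/mP]; apply.
  exact: (do_trans dl) xz.
Qed.

Lemma dense_order_dual (T : Type) (lt : T -> T -> Prop) :
  dense_order lt -> dense_order (fun x y => lt y x).
Proof.
case=> irr tr tot de ri le; split => //.
- by move=> x y z xy yz; exact: tr xy.
- by move=> x y; case: (tot x y); [constructor 3|constructor 2|constructor 1].
- by move=> x y /de[z [? ?]]; exists z.
Qed.

(** Density gives a point between the maximum of [l] and the minimum of [r]; if one list is empty,
    the absence of endpoints does. Minima are maxima of the dual order. *)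
Lemma finite_separation (T : eqType) (lt : T -> T -> Prop) (l r : seq T) :
  inhabited T -> dense_order lt ->
  (forall x y, x \in l -> y \in r -> lt x y) ->
  exists z, (forall x, x \in l -> lt x z) /\ (forall y, y \in r -> lt z y).
Proof.
move=> [x0] dl lr.
case: l lr => [|x l] lr; case: r lr => [|y r] lr.
- by exists x0.
- have [m mr mP] := finite_max r y (dense_order_dual dl).
  by have [z zm] := do_left dl m; exists z; split => // w; exact: mP.
- have [m mr mP] := finite_max l x dl.
  by have [z zm] := do_right dl m; exists z; split => // w; exact: mP.
have [m ml mP] := finite_max l x dl.
have [m' mr mP'] := finite_max r y (dense_order_dual dl).
have [z [mz zm]] := do_dense dl (lr _ _ ml mr).
by exists z; split => w; [exact: mP|exact: mP'].
Qed.

(** Only the strict orders are compared: totality and irreflexivity then make [s] the graph of a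
    finite injection. *)
Definition partial_iso (T1 T2 : eqType) (lt1 : T1 -> T1 -> Prop)
    (lt2 : T2 -> T2 -> Prop) (s : seq (T1 * T2)) : Prop :=
  forall x y x' y', (x, y) \in s -> (x', y') \in s -> (lt1 x x' <-> lt2 y y').

Lemma partial_iso_inj (T1 T2 : eqType) (lt1 : T1 -> T1 -> Prop)
    (lt2 : T2 -> T2 -> Prop) (s : seq (T1 * T2)) x y x' y' :
  dense_order lt1 -> dense_order lt2 -> partial_iso lt1 lt2 s ->
  (x, y) \in s -> (x', y') \in s -> (x = x' <-> y = y').
Proof.
move=> d1 d2 ps xy xy'; split=> [xx|yy].
  have [/(ps _ _ _ _ xy xy')||/(ps _ _ _ _ xy' xy)] := do_total d2 y y' => //;
    by rewrite xx => /(do_irr d1).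
have [/(ps _ _ _ _ xy xy')||/(ps _ _ _ _ xy' xy)] := do_total d1 x x' => //;
  by rewrite yy => /(do_irr d2).
Qed.

(** A new [x] cuts the domain of [s] into points below and points above; their images are cut in the
    same way, and any point separating them can serve as [y]. *)
Lemma partial_iso_forth (T1 T2 : eqType) (lt1 : T1 -> T1 -> Prop)
    (lt2 : T2 -> T2 -> Prop) (s : seq (T1 * T2)) x :
  inhabited T2 -> dense_order lt1 -> dense_order lt2 -> partial_iso lt1 lt2 s ->
  exists y, partial_iso lt1 lt2 ((x, y) :: s).
Proof.
move=> i2 d1 d2 ps.
have [[y xy]|nxy] := pselect (exists y, (x, y) \in s).
  exists y => a b a' b'; rewrite !inE => ab ab'; apply: ps.
    by case/predU1P: ab => // ->.
  by case/predU1P: ab' => // ->.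
pose l := [seq p.2 | p <- s & `[< lt1 p.1 x >]].
pose r := [seq p.2 | p <- s & `[< lt1 x p.1 >]].
have [] := @finite_separation T2 lt2 l r i2 d2.
  move=> _ _ /mapP[[a b] + ->] /mapP[[a' b'] + ->]; rewrite !mem_filter/=.
  move=> /andP[/asboolP ax ab] /andP[/asboolP xa ab'].
  by apply/(ps _ _ _ _ ab ab'); exact: (do_trans d1) ax xa.
move=> y [ly ry].
have lP a b : (a, b) \in s -> lt1 a x -> lt2 b y.
  move=> ab ax; apply: ly; apply/mapP; exists (a, b) => //.
  by rewrite mem_filter ab andbT; apply/asboolP.
have rP a b : (a, b) \in s -> lt1 x a -> lt2 y b.
  move=> ab ax; apply: ry; apply/mapP; exists (a, b) => //.
  by rewrite mem_filter ab andbT; apply/asboolP.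
have nP a b : (a, b) \in s -> lt1 a x \/ lt1 x a.
  move=> ab; case: (do_total d1 a x); [by left| |by right].
  by move=> ax; case: nxy; exists b; rewrite -ax.
exists y => a b a' b'; rewrite !inE.
move=> /predU1P[[-> ->]|ab] /predU1P[[-> ->]|ab'].
- by split => [/(do_irr d1)|/(do_irr d2)].
- split; first exact: rP.
  case: (nP _ _ ab') => // /(lP _ _ ab') yb_lt yb.
  by case: (do_irr d2 (do_trans d2 yb_lt yb)).
- split; first exact: lP.
  case: (nP _ _ ab) => // /(rP _ _ ab) yb yb_lt.
  by case: (do_irr d2 (do_trans d2 yb_lt yb)).
- exact: ps.
Qed.

Lemma partial_iso_swap (T1 T2 : eqType) (lt1 : T1 -> T1 -> Prop)
    (lt2 : T2 -> T2 -> Prop) (s : seq (T1 * T2)) :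
  partial_iso lt1 lt2 s <-> partial_iso lt2 lt1 [seq (p.2, p.1) | p <- s].
Proof.
split=> ps.
  by move=> _ _ _ _ /mapP[[x y] xy [-> ->]] /mapP[[x' y'] xy' [-> ->]];
    apply: iff_sym; exact: ps.
move=> x y x' y' xy xy'; apply: iff_sym; apply: ps; apply/mapP.
  by exists (x, y).
by exists (x', y').
Qed.

(** Any two points lie in a common finite partial isomorphism, so the limit preserves the order. An
    empty [s0] gives Cantor's theorem, a general one also homogeneity. *)
Lemma cantor_isomorphism (T1 T2 : eqType) (lt1 : T1 -> T1 -> Prop)
    (lt2 : T2 -> T2 -> Prop) (e1 : nat -> T1) (e2 : nat -> T2) s0 :
  (forall x, exists k, e1 k = x) -> (forall y, exists k, e2 k = y) ->
  dense_order lt1 -> dense_order lt2 -> partial_iso lt1 lt2 s0 ->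
  exists (f : T1 -> T2) (g : T2 -> T1),
    [/\ cancel f g, cancel g f, forall x y, (x, y) \in s0 -> f x = y &
        forall x x', lt1 x x' <-> lt2 (f x) (f x')].
Proof.
move=> e1P e2P d1 d2 ps0.
have [||||f [g [fK gK fs0 fP]]] := @back_and_forth T1 T2 e1 e2 e1P e2P
  (partial_iso lt1 lt2) _ _ _ s0 => //.
- by move=> s x y x' y'; exact: partial_iso_inj.
- by move=> s x; apply: partial_iso_forth => //; exists; exact: (e2 0%N).
- move=> s y /partial_iso_swap ps.
  have [|x px] := partial_iso_forth y _ d2 d1 ps; first by exists; exact: (e1 0%N).
  by exists x; apply/partial_iso_swap.
exists f, g; split => // x x'; have [s ps sP] := fP [:: x; x'].
by apply: ps; apply: sP; rewrite !inE eqxx ?orbT.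
Qed.

End DenseOrders.

(** * Scott's theorem *)

Section Invariance.
Context {L : language} {T : choiceType} (M : structure L T).

Lemma eval_aut (g : Aut M) n (v : n.-tuple T) (t : term L n) :
  Defs.eval M (map_tuple g v) t = g (Defs.eval M v t).
Proof.
elim: t => [i|f ts IH] /=; first by rewrite tnth_map.
rewrite -aut_fint; congr fint; apply: eq_from_tnth => i.
by rewrite tnth_mktuple tnth_map tnth_mktuple.
Qed.

Lemma map_tuple_cons (g : T -> T) n (v : n.-tuple T) (a : T) :
  [tuple of g a :: map_tuple g v] = map_tuple g [tuple of a :: v].
Proof. exact: val_inj. Qed.

(** Induction on the formula; at a quantifier, elements are carried from one side to the other by
    [g] and its inverse. *)
Lemma sat_aut (g : Aut M) n (phi : formula L n) (v : n.-tuple T) :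
  sat M phi (map_tuple g v) <-> sat M phi v.
Proof.
elim: phi v => {n} [n t u|n r ts|n p IH|n ps IH|n ps IH|n p IH|n p IH] v /=.
- by rewrite !eval_aut; split => [/(can_inj (autK g))|->].
- rewrite -[X in _ <-> X](aut_rint g).
  have -> : map_tuple g [tuple Defs.eval M v (ts i) | i < rar r] =
      [tuple Defs.eval M (map_tuple g v) (ts i) | i < rar r].
    by apply: eq_from_tnth => i; rewrite tnth_map !tnth_mktuple eval_aut.
  by [].
- by rewrite IH.
- by split=> h k; apply/IH.
- by split=> -[k h]; exists k; apply/IH.
- split=> -[a h].
    by exists (aut_inv g a); apply/IH; rewrite -map_tuple_cons autKV.
  by exists (g a); rewrite map_tuple_cons; apply/IH.
- split=> h a; first by apply/IH; rewrite -map_tuple_cons.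
  by rewrite -[a](autKV g) map_tuple_cons; apply/IH.
Qed.

Lemma definable_invariant n (D : set (n.-tuple T)) (g : Aut M) x :
  definable M D -> (D (map_tuple g x) <-> D x).
Proof. by move=> [phi phiP]; rewrite !phiP sat_aut. Qed.

Lemma map_tuple_cat (g : T -> T) n (x y : n.-tuple T) :
  [tuple of map_tuple g x ++ map_tuple g y] = map_tuple g [tuple of x ++ y].
Proof. by apply: val_inj => /=; rewrite map_cat. Qed.

Lemma definable2_invariant n (R : n.-tuple T -> n.-tuple T -> Prop) (g : Aut M) x y :
  definable2 M R -> (R (map_tuple g x) (map_tuple g y) <-> R x y).
Proof. by move=> [phi phiP]; rewrite !phiP map_tuple_cat sat_aut. Qed.

End Invariance.

(** * Tuples satisfying the same formulas are conjugate; invariant relations are definable *)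

Section ScottSentences.
Context {L : language} (M : structure L nat).

Definition equisat n (a b : n.-tuple nat) : Prop :=
  forall phi : formula L n, sat M phi a <-> sat M phi b.

Lemma equisat_sym n (a b : n.-tuple nat) : equisat a b -> equisat b a.
Proof. by move=> ab phi; apply: iff_sym; exact: ab. Qed.

Definition nth_tuple n (k : nat) : n.-tuple nat :=
  odflt (nseq_tuple n 0%N) (unpickle k).

Lemma nth_tuple_surj n (a : n.-tuple nat) : exists k, nth_tuple n k = a.
Proof. by exists (pickle a); rewrite /nth_tuple pickleK. Qed.

(** The variable is bound so that the formula exists for [n = 0] too. *)
Definition FFalse n : formula L n :=
  FExists (FNot (FEq (Var L ord0) (Var L ord0))).

Lemma sat_FFalse n (v : n.-tuple nat) : ~ sat M (FFalse n) v.
Proof. by move=> [a]; apply. Qed.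

(* Only countably many tuples have to be separated from [a], so a countable
   conjunction suffices however large the language is. *)
Lemma isolating_formula n (a : n.-tuple nat) :
  exists2 phi : formula L n, sat M phi a & forall b, sat M phi b -> equisat a b.
Proof.
have /choice[sep sepP] : forall k, exists phi : formula L n,
    sat M phi a /\ (sat M phi (nth_tuple n k) -> equisat a (nth_tuple n k)).
  move=> k; set b := nth_tuple n k.
  have [ab|/existsNP[phi nphi]] := pselect (equisat a b).
    by exists (FNot (FFalse n)); split => //; exact: sat_FFalse.
  have [pa|npa] := pselect (sat M phi a).
    by exists phi; split => // pb; case: nphi.
  by exists (FNot phi); split => // npb; case: nphi.
exists (FConj sep) => [k|b sepb]; first by case: (sepP k).
by have [k kb] := nth_tuple_surj b; have := sepb k; rewrite -kb; case: (sepP k).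
Qed.

(** A formula isolating [x :: a], quantified existentially, holds of [a], hence of [b]; a witness
    for [b] is the wanted [y]. *)
Lemma equisat_forth n (a b : n.-tuple nat) x : equisat a b ->
  exists y, equisat [tuple of x :: a] [tuple of y :: b].
Proof.
move=> ab; have [phi phia phiP] := isolating_formula [tuple of x :: a].
have /ab[y phiy] : sat M (FExists phi) a by exists x.
by exists y; exact: phiP.
Qed.

Lemma mem_zip_tuple n (a b : n.-tuple nat) x y :
  (x, y) \in zip a b -> exists i, tnth a i = x /\ tnth b i = y.
Proof.
move=> /tnthP[i]; rewrite (tnth_nth (x, y)) /= nth_zip ?size_tuple// => -[ax yb].
have lti : (i < n)%N by rewrite (leq_trans (ltn_ord i)) // size_zip !size_tuple minnn.
by exists (Ordinal lti); rewrite (tnth_nth x) (tnth_nth y).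
Qed.

(** Back and forth on pairs of equivalent tuples. The limit respects each symbol because one
    instance of it involves finitely many points, which an atomic formula compares inside a single
    such pair. *)
Lemma equisat_aut n (a b : n.-tuple nat) : equisat a b ->
  exists g : Aut M, map_tuple g a = b.
Proof.
move=> ab; pose P (s : seq (nat * nat)) := exists m (c d : m.-tuple nat),
  s = zip c d /\ equisat c d.
have Pext s : P s -> exists m (c d : m.-tuple nat), equisat c d /\
    forall x y, (x, y) \in s -> exists i, tnth c i = x /\ tnth d i = y.
  move=> [m [c [d [-> cd]]]]; exists m, c, d; split => // x y.
  exact: mem_zip_tuple.
have [||||||f [g [fK gK fab fP]]] := @back_and_forth nat nat id id _ _ P _ _ _ (zip a b).
- by move=> x; exists x.
- by move=> x; exists x.
- move=> s x y x' y' /Pext[m [c [d [cd sP]]]] /sP[i [<- <-]] /sP[j [<- <-]].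
  exact: (cd (FEq (Var L i) (Var L j))).
- move=> _ x [m [c [d [-> cd]]]]; have [y xy] := equisat_forth x cd.
  by exists y, m.+1, [tuple of x :: c], [tuple of y :: d].
- move=> _ y [m [c [d [-> cd]]]].
  have [x xy] := equisat_forth y (equisat_sym cd).
  exists x, m.+1, [tuple of x :: c], [tuple of y :: d]; split => //.
  exact: equisat_sym.
- by exists n, a, b.
(* Any finite list of points sits among the coordinates of some [c], with the images under [f] at
   the same coordinates of an equivalent [d]. *)
have fidx (xs : seq nat) : exists m (c d : m.-tuple nat), equisat c d /\
    forall x, x \in xs -> exists i, tnth c i = x /\ tnth d i = f x.
  have [s /Pext[m [c [d [cd sP]]]] xsP] := fP xs.
  by exists m, c, d; split => // x /xsP /sP.
have ffint (F : Defs.fsym L) (x : (far F).-tuple nat) :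
    fint M (map_tuple f x) = f (fint M x).
  (* The value joins its arguments in the list, so that one equation between terms in the
     coordinates expresses it. *)
  have [m [c [d [cd cdP]]]] := fidx (fint M x :: x).
  have [j [cj dj]] := cdP (fint M x) (mem_head _ _).
  have /choice[t tP] : forall i, exists j, tnth c j = tnth x i /\ tnth d j = f (tnth x i).
    by move=> i; apply: cdP; rewrite inE mem_tnth orbT.
  have := cd (FEq (App (fun i => Var L (t i))) (Var L j)).
  rewrite /= cj dj => -[+ _].
  have -> : [tuple tnth c (t i) | i < far F] = x.
    by apply: eq_from_tnth => i; rewrite tnth_mktuple; case: (tP i).
  have -> : [tuple tnth d (t i) | i < far F] = map_tuple f x.
    by apply: eq_from_tnth => i; rewrite tnth_mktuple tnth_map; case: (tP i).
  exact.
have frint (r : rsym L) (x : (rar r).-tuple nat) :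
    rint M (map_tuple f x) <-> rint M x.
  have [m [c [d [cd cdP]]]] := fidx x.
  have /choice[t tP] : forall i, exists j, tnth c j = tnth x i /\ tnth d j = f (tnth x i).
    by move=> i; apply: cdP; rewrite mem_tnth.
  have := cd (FRel (fun i => Var L (t i))).
  rewrite /=.
  have -> : [tuple tnth c (t i) | i < rar r] = x.
    by apply: eq_from_tnth => i; rewrite tnth_mktuple; case: (tP i).
  have -> : [tuple tnth d (t i) | i < rar r] = map_tuple f x.
    by apply: eq_from_tnth => i; rewrite tnth_mktuple tnth_map; case: (tP i).
  by move=> ?; apply: iff_sym.
exists (MkAut fK gK ffint frint); apply: eq_from_tnth => i; rewrite tnth_map /=.
apply: fab; have -> : (tnth a i, tnth b i) = nth (tnth a i, tnth b i) (zip a b) i.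
  by rewrite nth_zip ?size_tuple// -!tnth_nth.
by rewrite mem_nth// size_zip !size_tuple minnn.
Qed.

(** An isolating formula of [a] defines the orbit of [a]. An invariant [D] is a union of orbits, and
    countably many tuples make the disjunction over its members a formula. *)
Lemma invariant_definable n (D : set (n.-tuple nat)) :
  (forall (g : Aut M) x, D x -> D (map_tuple g x)) -> definable M D.
Proof.
move=> Dinv; have /choice[phi phiP] : forall k, exists phi : formula L n,
    (forall b, sat M phi b -> D b) /\ (D (nth_tuple n k) -> sat M phi (nth_tuple n k)).
  move=> k; set a := nth_tuple n k; have [Da|nDa] := pselect (D a).
    have [phi phia phiP] := isolating_formula a.
    exists phi; split => // b pb; have [g <-] := equisat_aut (phiP _ pb); exact: Dinv.
  by exists (FFalse n); split => // b /sat_FFalse.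
exists (FDisj phi) => x; split => [|[k]]; last by case: (phiP k) => + _; apply.
by have [k <-] := nth_tuple_surj x => Dx; exists k; case: (phiP k) => _; apply.
Qed.

Lemma invariant_definable2 n (R : n.-tuple nat -> n.-tuple nat -> Prop) :
  (forall (g : Aut M) x y, R x y -> R (map_tuple g x) (map_tuple g y)) ->
  definable2 M R.
Proof.
move=> Rinv.
have [|phi phiP] := @invariant_definable (n + n)%N
  [set z | exists x y : n.-tuple nat, z = [tuple of x ++ y] /\ R x y].
  move=> g _ [x [y [-> xy]]]; exists (map_tuple g x), (map_tuple g y).
  by rewrite map_tuple_cat; split => //; exact: Rinv.
exists phi => x y; rewrite -phiP; split => [xy|]; first by exists x, y.
(* Both halves have length [n], so the concatenation determines them. *)
move=> [x' [y' [/(congr1 val) /= /eqP]]].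
by rewrite eqseq_cat ?size_tuple// => /andP[/eqP/val_inj -> /eqP/val_inj ->].
Qed.

End ScottSentences.

(** * The order of the rationals *)

Lemma rat_dense_order : dense_order (fun x y : rat => (x < y)%R).
Proof.
split.
- by move=> x; rewrite ltxx.
- by move=> x y z; exact: lt_trans.
- by move=> x y; case: (ltgtP x y); [constructor 1|constructor 3|constructor 2].
- by move=> x y xy; exists ((x + y) / 2%:R)%R; rewrite !midf_lt.
- by move=> x; exists (x + 1)%R; rewrite ltrDl.
- by move=> x; exists (x - 1)%R; rewrite gtrBl.
Qed.

Definition nth_rat (k : nat) : rat := odflt 0%R (unpickle k).

Lemma nth_rat_surj (q : rat) : exists k, nth_rat k = q.
Proof. by exists (pickle q); rewrite /nth_rat pickleK. Qed.

Lemma aut_rat_lt (u : Aut rat_lt) (p q : rat) : (u p < u q)%R = (p < q)%R.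
Proof. by have [h h'] := @aut_rint _ _ rat_lt u tt [tuple p; q]; apply/idP/idP. Qed.

Lemma exists_aut_rat (f g : rat -> rat) : cancel f g -> cancel g f ->
  {mono f : p q / (p < q)%R} -> exists u : Aut rat_lt, u =1 f.
Proof.
move=> fK gK fm.
have fr (r : Defs.rsym order_language) (x : (rar r).-tuple rat) :
    rint rat_lt (map_tuple f x) <-> rint rat_lt x.
  by rewrite /= !tnth_map fm.
have ff (F : Defs.fsym order_language) (x : (far F).-tuple rat) :
  fint rat_lt (map_tuple f x) = f (fint rat_lt x) by case: F x.
by exists (MkAut fK gK ff fr).
Qed.

(** The pairs [(p i, q i)] form a finite partial isomorphism, which back and forth extends to all
    rationals. *)
Lemma rat_homogeneous k (p q : 'I_k -> rat) :
  (forall i j : 'I_k, (i < j)%N -> (p i < p j)%R) ->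
  (forall i j : 'I_k, (i < j)%N -> (q i < q j)%R) ->
  exists u : Aut rat_lt, forall i, u (p i) = q i.
Proof.
move=> pinc qinc; pose s0 := [seq (p i, q i) | i <- enum 'I_k].
have [|f [g [fK gK fs fm]]] := @cantor_isomorphism rat rat _ _ nth_rat nth_rat s0
  nth_rat_surj nth_rat_surj rat_dense_order rat_dense_order.
- move=> _ _ _ _ /mapP[i _ [-> ->]] /mapP[j _ [-> ->]].
  have [ij|ji|/val_inj ->] := ltngtP i j.
  + by rewrite pinc// qinc.
  + by rewrite !ltNge !ltW// ?pinc// qinc.
  + by rewrite !ltxx.
have fmono : {mono f : x y / (x < y)%R} by move=> x y; have [h h'] := fm x y; apply/idP/idP.
have [u uf] := exists_aut_rat fK gK fmono.
by exists u => i; rewrite uf; apply: fs; apply/mapP; exists i; rewrite ?mem_enum.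
Qed.

(** * From a homomorphism to classes *)

Section Images.
Context {L : language} {T : choiceType} (M : structure L T) (n : nat).
Implicit Types (g h : Aut M) (C : set (n.-tuple T)).

Lemma aut_imageM g h C : aut_image (aut_comp g h) C = aut_image g (aut_image h C).
Proof.
apply/seteqP; split=> [_ [x Cx <-]|_ [_ [x Cx <-] <-]].
  by exists (map_tuple h x); [exists x|rewrite -map_tuple_comp].
by exists x => //; rewrite -map_tuple_comp.
Qed.

Lemma aut_image1 C : aut_image (aut_one M) C = C.
Proof.
apply/seteqP; split=> [_ [x Cx <-]|x Cx]; first by rewrite map_tuple_id.
by exists x; rewrite ?map_tuple_id.
Qed.

Lemma aut_image_class (E : n.-tuple T -> set (n.-tuple T)) g x :
  definable2 M E -> aut_image g (E x) = E (map_tuple g x).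
Proof.
move=> dE; apply/seteqP; split=> [_ [y Exy <-]|y]; first exact/definable2_invariant.
rewrite -[y](map_tuple_autKV g) => /(definable2_invariant _ _ _ dE) Exy.
by exists (map_tuple (aut_inv g) y).
Qed.

End Images.

(** * The classes indexed by the rationals *)

Section ClassesOfHomomorphism.
Context {L : language} (A : structure L nat).
Context (F : {multiplicative Aut A -> Aut rat_lt}).
Hypothesis F_surj : forall u, exists g, F g = u.
Context (n : nat) (a : n.-tuple nat).
Hypothesis F_stab : forall g : Aut A, map_tuple g a = a -> F g 0%R = 0%R.

(** The fiber over [q] of the map sending [g a] to [F g 0], defined on the orbit of [a]. *)
Definition fiber (q : rat) : set (n.-tuple nat) :=
  [set map_tuple g a | g in [set g : Aut A | F g 0%R = q]].

Lemma F_comp (g h : Aut A) (q : rat) : F (aut_comp g h) q = F g (F h q).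
Proof. by have -> : F (aut_comp g h) = aut_comp (F g) (F h) by exact: gmulfM. Qed.

(** If [g a = h a], then the inverse of [g] composed with [h] fixes [a], so its image under [F]
    fixes 0 and [F g 0 = F h 0]. *)
Lemma fiber_inj p q x : fiber p x -> fiber q x -> p = q.
Proof.
move=> [g <- <-] [h <- ha]; have := F_stab (g := aut_comp (aut_opp g) h) _.
rewrite map_tuple_comp ha -map_tuple_comp => stab.
have {}stab : F (aut_comp (aut_opp g) h) 0%R = 0%R.
  apply: stab; apply: eq_from_tnth => i; rewrite tnth_map /=; exact: autK.
rewrite -[in LHS]stab -F_comp; congr (F _ _).
by apply: aut_eq => y /=; rewrite autKV.
Qed.

(** Some automorphism of the rationals moves 0 to [q], and [F] is onto. *)
Lemma fiber_neq0 q : exists x, fiber q x.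
Proof.
have [||u uq] := @rat_homogeneous 1 (fun=> 0%R) (fun=> q).
- by move=> i j; rewrite (ord1 i) (ord1 j) ltnn.
- by move=> i j; rewrite (ord1 i) (ord1 j) ltnn.
by have [g Fg] := F_surj u; exists (map_tuple g a), g => //=; rewrite Fg (uq ord0).
Qed.

Lemma fiberP p q : fiber p = fiber q -> p = q.
Proof. by have [x px] := fiber_neq0 p => pq; apply: (fiber_inj px); rewrite -pq. Qed.

Lemma aut_image_fiber (g : Aut A) q : aut_image g (fiber q) = fiber (F g q).
Proof.
apply/seteqP; split=> [_ [_ [h <- <-] <-]|_ [h hq <-]].
  by exists (aut_comp g h); [exact: F_comp|exact: map_tuple_comp].
exists (map_tuple (aut_comp (aut_opp g) h) a).
  exists (aut_comp (aut_opp g) h) => //=; apply: (can_inj (autK (F g))).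
  rewrite -F_comp -hq; congr (F _ _).
  by apply: aut_eq => x /=; rewrite autKV.
by rewrite -map_tuple_comp; apply: eq_from_tnth => i; rewrite !tnth_map /= autKV.
Qed.

Lemma fiber_image (g : Aut A) q x : fiber q x -> fiber (F g q) (map_tuple g x).
Proof. by move=> qx; rewrite -aut_image_fiber; exists x. Qed.

Definition fiber_dom : set (n.-tuple nat) := [set x | exists q, fiber q x].

Definition fiber_eq (x : n.-tuple nat) : set (n.-tuple nat) :=
  [set y | exists2 q, fiber q x & fiber q y].

(** The order of the rationals carried to the fibers; it is faithful because distinct rationals have
    distinct fibers. *)
Definition fiber_lt (C C' : set (n.-tuple nat)) : Prop :=
  exists p q, [/\ C = fiber p, C' = fiber q & (p < q)%R].

Lemma fiber_eqE q x : fiber q x -> fiber_eq x = fiber q.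
Proof.
move=> qx; apply/seteqP; split=> [y [p px]|y qy]; last by exists q.
by rewrite (fiber_inj px qx).
Qed.

Lemma fiber_ltE p q : fiber_lt (fiber p) (fiber q) <-> (p < q)%R.
Proof. by split=> [[p' [q' [/fiberP -> /fiberP ->]]]|pq]; last by exists p, q. Qed.

Lemma fiber_classes C :
  classes fiber_dom fiber_eq C <-> exists q, fiber q = C.
Proof.
split=> [[x [q qx] <-]|[q <-]]; first by exists q; rewrite (fiber_eqE qx).
by have [x qx] := fiber_neq0 q; exists x; [exists q|exact: fiber_eqE].
Qed.

Lemma fiber_equivalence : equivalence_on fiber_dom fiber_eq.
Proof.
split.
- by move=> x y [q qx qy]; split; exists q.
- by move=> x [q qx]; exists q.
- by move=> x y [q qx qy]; exists q.
- move=> x y z [q qx qy] [p py pz]; exists q => //.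
  by rewrite (fiber_inj qy py).
Qed.

Lemma fiber_strict_linear_order :
  strict_linear_order_on (classes fiber_dom fiber_eq) fiber_lt.
Proof.
split.
- by move=> _ /fiber_classes[q <-] /fiber_ltE; rewrite ltxx.
- move=> _ _ _ /fiber_classes[p <-] /fiber_classes[q <-] /fiber_classes[r <-].
  by move=> /fiber_ltE pq /fiber_ltE qr; apply/fiber_ltE; exact: lt_trans qr.
- move=> _ _ /fiber_classes[p <-] /fiber_classes[q <-].
  case: (ltgtP p q) => [?|?|->]; [constructor 1|constructor 3|by constructor 2];
    exact/fiber_ltE.
Qed.

(** By Scott's theorem invariance is enough: [g] moves the fiber of [p] to that of [F g p], and
    [F g] preserves the order. *)
Lemma fiber_definable_order : definable_order A fiber_dom fiber_eq fiber_lt.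
Proof.
split; first exact: fiber_strict_linear_order.
apply: invariant_definable2 => g x y [[p px] [q qy]].
rewrite (fiber_eqE px) (fiber_eqE qy) => /fiber_ltE pq.
have gpx := fiber_image g px; have gqy := fiber_image g qy.
split; [by exists (F g p)|by exists (F g q)|].
by rewrite (fiber_eqE gpx) (fiber_eqE gqy); apply/fiber_ltE; rewrite aut_rat_lt.
Qed.

Lemma fiber_infinite : infinite_set (classes fiber_dom fiber_eq).
Proof.
have -> : classes fiber_dom fiber_eq = fiber @` setT.
  by apply/seteqP; split=> C; rewrite fiber_classes => -[q]; exists q.
rewrite (eq_finite_set (inj_card_eq _)); first exact: infinite_rat.
by move=> p q _ _; exact: fiberP.
Qed.

(** Both clauses are read on the indices: an automorphism of the rationals does what is asked, by
    homogeneity or by definition, and surjectivity of [F] lifts it. *)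
Lemma fiber_order_indiscernible :
  order_indiscernible A (classes fiber_dom fiber_eq) fiber_lt.
Proof.
split=> [k c d [cK cinc] [dK dinc]|h [[hK hinj hsurj] hlt]].
  have /choice[p pc] : forall i, exists q, fiber q = c i.
    by move=> i; exact/fiber_classes.
  have /choice[q qd] : forall i, exists q, fiber q = d i.
    by move=> i; exact/fiber_classes.
  have [||u upq] := @rat_homogeneous k p q.
  - by move=> i j /cinc; rewrite -!pc => /fiber_ltE.
  - by move=> i j /dinc; rewrite -!qd => /fiber_ltE.
  have [g gu] := F_surj u; exists g => i.
  by rewrite -pc -qd aut_image_fiber gu upq.
have Kf q : classes fiber_dom fiber_eq (fiber q) by apply/fiber_classes; exists q.
(* [f] is the permutation [h] read on the indices, and [f'] is its inverse. *)
have /choice[f fP] : forall q, exists p, fiber p = h (fiber q).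
  by move=> q; apply/fiber_classes; exact: hK.
have /choice[f' f'P] : forall q, exists p, fiber q = h (fiber p).
  move=> q; have [_ /fiber_classes[p <-] hp] := hsurj _ (Kf q).
  by exists p.
have f'K : cancel f' f by move=> q; apply: fiberP; rewrite fP -f'P.
have fK : cancel f f'.
  move=> q; apply: fiberP; apply: hinj; rewrite ?inE//.
  by rewrite -f'P fP.
have fmono : {mono f : p q / (p < q)%R}.
  move=> p q; have := hlt _ _ (Kf p) (Kf q); rewrite -!fP !fiber_ltE => -[h1 h2].
  exact/idP/idP.
have [u uf] := exists_aut_rat fK f'K fmono; have [g gu] := F_surj u.
by exists g => _ /fiber_classes[q <-]; rewrite aut_image_fiber gu uf fP.
Qed.

End ClassesOfHomomorphism.

(** Bundles a bare function, such as one obtained by choice, as a homomorphism. *)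
Lemma multiplicative_packaging (G H : magmaType) (f : G -> H) :
  {morph f : x y / (x * y)%g} -> exists F : {multiplicative G -> H}, F =1 f.
Proof.
move=> fM; pose F : {multiplicative G -> H} := HB.pack f (isMultiplicative.Build G H f fM).
by exists F.
Qed.

(** * From classes to a homomorphism *)

Section HomomorphismOfClasses.
Context {L : language} (A : structure L nat) (n : nat).
Context (D : set (n.-tuple nat)) (E : n.-tuple nat -> set (n.-tuple nat)).
Context (lt : set (n.-tuple nat) -> set (n.-tuple nat) -> Prop).
Hypotheses (defD : definable A D) (defE : definable2 A E).
Hypothesis infE : infinite_set (classes D E).
Hypotheses (defLt : definable_order A D E lt).
Hypothesis indisc : order_indiscernible A (classes D E) lt.

Local Notation K := (classes D E).

Lemma classes_aut (g : Aut A) C : K C -> K (aut_image g C).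
Proof.
move=> [x Dx <-]; rewrite aut_image_class//; exists (map_tuple g x) => //.
exact/definable_invariant.
Qed.

(** The order is definable as a relation between representatives, hence invariant. *)
Lemma order_aut (g : Aut A) C C' : K C -> K C' -> lt C C' ->
  lt (aut_image g C) (aut_image g C').
Proof.
move=> [x Dx <-] [y Dy <-] xy; rewrite !aut_image_class//.
have [_ def2] := defLt.
by have [_ /(_ (And3 Dx Dy xy))[]] := definable2_invariant g x y def2.
Qed.

Lemma aut_imageK (g : Aut A) (C : set (n.-tuple nat)) :
  aut_image (aut_opp g) (aut_image g C) = C.
Proof.
rewrite -aut_imageM (_ : aut_comp _ _ = aut_one A) ?aut_image1//.
by apply: aut_eq => x /=; rewrite autK.
Qed.

Lemma indiscernible1 C C' : K C -> K C' -> exists g : Aut A, aut_image g C = C'.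
Proof.
move=> KC KC'; case: indisc => + _.
case/(_ 1%N (fun=> C) (fun=> C')) => [||g /(_ ord0)]; last by exists g.
- by split => // i j; rewrite (ord1 i) (ord1 j) ltnn.
- by split => // i j; rewrite (ord1 i) (ord1 j) ltnn.
Qed.

Lemma indiscernible2 C1 C2 C1' C2' : K C1 -> K C2 -> K C1' -> K C2' ->
  lt C1 C2 -> lt C1' C2' ->
  exists g : Aut A, aut_image g C1 = C1' /\ aut_image g C2 = C2'.
Proof.
move=> K1 K2 K1' K2' lt12 lt12'.
pose pair (X Y : set (n.-tuple nat)) (i : 'I_2) := if i == ord0 then X else Y.
have incP X Y : K X -> K Y -> lt X Y -> increasing_in K lt (pair X Y).
  move=> KX KY XY; split=> [i|i j]; first by rewrite /pair; case: ifP.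
  by case: i j => [[|[|//]] ?] [[|[|//]] ?].
case: indisc => /(_ 2%N (pair C1 C2) (pair C1' C2')) + _.
case=> [||g gP]; [exact: incP|exact: incP|exists g].
by split; [exact: gP ord0|exact: (gP ord_max)].
Qed.

Lemma exists_lt_classes : exists C1 C2, [/\ K C1, K C2 & lt C1 C2].
Proof.
have [C KC] := infinite_setN0 infE.
have [C' [KC' CC']] : exists C', K C' /\ C' <> C.
  apply: contrapT => noC'; apply: infE; apply: sub_finite_set (finite_set1 C).
  by move=> C' KC'; apply: contrapT => CC'; apply: noC'; exists C'.
have [[_ _ tot] _] := defLt; case: (tot _ _ KC KC') => [?|CE|?].
- by exists C, C'.
- by case: CC'.
- by exists C', C.
Qed.

(** The classes become a type here, since [cantor_isomorphism] is about types. *)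
Definition class_lt (C C' : set_type K) : Prop := lt (val C) (val C').

Lemma set_typeP C : K C -> exists C' : set_type K, val C' = C.
Proof. by move=> KC; exists (SigSub (mem_set KC)). Qed.

Lemma set_type_mem (C : set_type K) : K (val C).
Proof. exact: set_valP. Qed.

(* Homogeneity for one and two classes, together with a single pair
   [C1 < C2], forces the order of the rationals. *)
Lemma class_dense_order : dense_order class_lt.
Proof.
have [[irr tr tot] _] := defLt; have [C1 [C2 [K1 K2 lt12]]] := exists_lt_classes.
have right C : K C -> exists2 C', K C' & lt C C'.
  move=> KC; have [g <-] := indiscernible1 K1 KC.
  by exists (aut_image g C2); [exact: classes_aut|exact: order_aut].
split.
- by move=> C; apply: irr; exact: set_type_mem.
- by move=> X Y Z; apply: tr; exact: set_type_mem.
- move=> X Y; case: (tot (val X) (val Y)); try exact: set_type_mem.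
  + by constructor 1.
  + by move=> /val_inj; constructor 2.
  + by constructor 3.
(* Transport [C1 < C2 < C3] so that the outer classes become [X] and [Y]; the image of [C2] lies
   between them. *)
- move=> X Y XY; have [C3 K3 lt23] := right _ K2.
  have lt13 := tr _ _ _ K1 K2 K3 lt12 lt23.
  have [g [gX gY]] := indiscernible2 K1 K3 (set_type_mem X) (set_type_mem Y) lt13 XY.
  have [Z ZE] := set_typeP (classes_aut g K2).
  by exists Z; rewrite /class_lt ZE -gX -gY; split; exact: order_aut.
- move=> X; have [C KC XC] := right _ (set_type_mem X).
  by have [Y YE] := set_typeP KC; exists Y; rewrite /class_lt YE.
(* Moving [C2] to [X] puts the image of [C1] below [X]. *)
- move=> X; have [g gX] := indiscernible1 K2 (set_type_mem X).
  have [Y YE] := set_typeP (classes_aut g K1); exists Y.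
  by rewrite /class_lt YE -gX; exact: order_aut.
Qed.

(** Classes are enumerated through their representatives, with [X0] available for tuples outside
    [D]. *)
Lemma class_enumeration : exists e : nat -> set_type K, forall C, exists k, e k = C.
Proof.
have [C0 KC0] := infinite_setN0 infE; have [X0 _] := set_typeP KC0.
have /choice[e eP] : forall k, exists X : set_type K,
    D (nth_tuple n k) -> val X = E (nth_tuple n k).
  move=> k; have [Dk|nDk] := pselect (D (nth_tuple n k)); last by exists X0.
  by have [|X XE] := @set_typeP (E (nth_tuple n k)); [exists (nth_tuple n k)|exists X].
exists e => X; have [x Dx xX] := set_type_mem X.
have [k kx] := nth_tuple_surj x; exists k; apply: val_inj.
by rewrite eP kx.
Qed.

(** Cantor's theorem identifies the classes with the rationals, and the action of [Aut A] on the
    classes is conjugated along this identification. *)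
Lemma classes_homomorphism : exists F : {multiplicative Aut A -> Aut rat_lt},
  continuous F /\ set_surj [set: Aut A] [set: Aut rat_lt] F.
Proof.
have [e eP] := class_enumeration.
have [|f [g [fK gK _ fm]]] := @cantor_isomorphism (set_type K) rat _ _ e nth_rat [::]
  eP nth_rat_surj class_dense_order rat_dense_order; first by [].
have actP : forall hC : Aut A * set_type K, exists C : set_type K,
    val C = aut_image hC.1 (val hC.2).
  by move=> [h C]; apply: set_typeP; apply: classes_aut; exact: set_type_mem.
have [act {}actP] := choice actP.
have actK (h : Aut A) : cancel (fun C => act (h, C)) (fun C => act (aut_opp h, C)).
  by move=> C; apply: val_inj; rewrite !actP /= ?actP aut_imageK.
have act_lt (h : Aut A) C C' : class_lt C C' -> class_lt (act (h, C)) (act (h, C')).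
  by rewrite /class_lt !actP; apply: order_aut; exact: set_type_mem.
have optK (h : Aut A) : aut_opp (aut_opp h) = h by exact: aut_eq.
have act_mono (h : Aut A) C C' : class_lt (act (h, C)) (act (h, C')) <-> class_lt C C'.
  split; last exact: act_lt.
  by move=> /(act_lt (aut_opp h)); rewrite !actK.
have /choice[F0 F0P] : forall h : Aut A, exists u : Aut rat_lt,
    u =1 (fun q => f (act (h, g q))).
  move=> h; apply: (@exists_aut_rat _ (fun q => f (act (aut_opp h, g q)))).
  - by move=> q; rewrite fK actK gK.
  (* Writing [h] as a double inverse turns [actK] into the cancellation on the other side. *)
  - by move=> q; rewrite fK -{1}(optK h) actK gK.
  - move=> p q; have [f1 f2] := fm (act (h, g p)) (act (h, g q)).
    have [g1 g2] := fm (g p) (g q); have [a1 a2] := act_mono h (g p) (g q).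
    rewrite !gK in g1 g2.
    by apply/idP/idP => [/f2/a1/g1|/g2/a2/f1].
have F0M : {morph F0 : x y / (x * y)%g}.
  move=> x y; apply: aut_eq => q.
  rewrite (_ : (F0 x * F0 y)%g q = F0 x (F0 y q)) // !F0P fK; congr f.
  by apply: val_inj; rewrite !actP /= ?actP aut_imageM.
have [F FE] := multiplicative_packaging F0M; exists F; split.
(* Continuity: [F h q] depends only on the image of the class [g q], which the image of one
   representative [x] determines. *)
- move=> h; apply: (aut_cvg (fmap_filter F (nbhs_filter h))) => q; rewrite FE F0P.
  have [x Dx xq] := set_type_mem (g q).
  apply: filterS (aut_nbhs_tuple h x) => h' /= hx; rewrite FE F0P; congr f; apply: val_inj.
  by rewrite !actP /= -xq !aut_image_class// hx.
- move=> u _.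
  (* [s] is [u] conjugated to the classes, as a function on all sets of tuples; its values outside
     [K] are left open. *)
  have /choice[s sP] : forall C, exists C', K C -> exists X : set_type K,
      val X = C /\ C' = val (g (u (f X))).
    move=> C; have [KC|nKC] := pselect (K C); last by exists C.
    by have [X XE] := set_typeP KC; exists (val (g (u (f X)))) => _; exists X.
  have sE (X : set_type K) : s (val X) = val (g (u (f X))).
    by have [Y [/val_inj -> ->]] := sP _ (set_type_mem X).
  have s_op : order_preserving_perm K lt s.
    split.
      split.
      + move=> _ /set_typeP[X <-]; rewrite sE; exact: set_type_mem.
      + move=> _ _ /set_mem/set_typeP[X <-] /set_mem/set_typeP[Y <-].
        rewrite !sE => /val_inj/(can_inj gK)/(can_inj (autK u))/(can_inj fK).
        by move=> ->.
      + move=> _ /set_typeP[X <-]; exists (val (g (aut_inv u (f X)))).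
          exact: set_type_mem.
        by rewrite sE gK autKV fK.
    move=> _ _ /set_typeP[X <-] /set_typeP[Y <-]; rewrite !sE.
    have [f1 f2] := fm X Y; have [f3 f4] := fm (g (u (f X))) (g (u (f Y))).
    move: f3 f4; rewrite !gK aut_rat_lt => f3 f4.
    by split=> [/f1/f4|/f3/f2].
  have [h hs] := indisc.2 _ s_op; exists h => //; apply: aut_eq => q.
  rewrite FE F0P (_ : act (h, g q) = g (u q)) ?gK//; apply: val_inj.
  by rewrite actP /= hs ?sE ?gK//; exact: set_type_mem.
Qed.

End HomomorphismOfClasses.

(** * The equivalence, with the base tuple supplied by continuity at the identity *)

Theorem theorem4p1 (L : language) (A : structure L nat) :
  (exists F : {multiplicative Aut A -> Aut rat_lt},
      continuous F /\ set_surj [set: Aut A] [set: Aut rat_lt] F) <->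
  (exists (n : nat) (D : set (n.-tuple nat))
          (E : n.-tuple nat -> set (n.-tuple nat))
          (lt : set (n.-tuple nat) -> set (n.-tuple nat) -> Prop),
      definable A D /\
      (equivalence_on D E /\ definable2 A E) /\
      infinite_set (classes D E) /\
      definable_order A D E lt /\
      order_indiscernible A (classes D E) lt).
Proof.
split=> [[F [Fc Fs]]|[n [D [E [lt [defD [[eqE defE] [infE [defLt indisc]]]]]]]]].
  have Fsurj u : exists g, F g = u by have [g _ <-] := Fs u I; exists g.
  have near1 : nbhs (aut_one A) (F @^-1` [set u : Aut rat_lt | u 0%R = F (aut_one A) 0%R]).
    by apply: Fc; exact: aut_nbhs_eval.
  have [s sP] := aut_nbhs_finite near1.
  (* [F 1] is an injective idempotent, so it fixes 0. *)
  have F1 : F (aut_one A) 0%R = 0%R.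
    apply: (can_inj (autK (F (aut_one A)))); rewrite -F_comp.
    by congr (F _ _); exact: aut_eq.
  have Fstab (g : Aut A) : map_tuple g (in_tuple s) = in_tuple s -> F g 0%R = 0%R.
    move=> gs; rewrite -[RHS]F1; apply: sP => x /(nthP 0%N)[i si <-] /=.
    by have /(congr1 (fun t : _.-tuple nat => nth 0%N t i)) := gs; rewrite /= (nth_map 0%N).
  (* The finite list [s] that controls [F g 0] near the identity is the base tuple of the fibers. *)
  exists (size s), (fiber_dom F (in_tuple s)),
    (fiber_eq F (in_tuple s)), (fiber_lt F (in_tuple s)).
  split.
    apply: invariant_definable => g x [q qx]; exists (F g q).
    exact: fiber_image.
  split.
    split; first exact: fiber_equivalence.
    apply: invariant_definable2 => g x y [q qx qy].
    by exists (F g q); exact: fiber_image.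
  split; first exact: fiber_infinite.
  split; first exact: fiber_definable_order.
  exact: fiber_order_indiscernible.
exact: classes_homomorphism defD defE infE defLt indisc.
Qed.
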